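(* Let $\nu>-\frac12$ and let $j_{\nu,1}$ be the least positive zero of the Bessel function $J_\nu(x)$. Then $$j_{\nu,1}>\frac{\left((2\nu+1)^{2/3}+2^{2/3}\right)^{3/2}}{2}.$$
   Context: $J_\nu$ is the Bessel function of the first kind of order $\nu$, given for $x>0$ by $J_\nu(x)=\sum_{i=0}^\infty \frac{(-1)^i}{i!\,\Gamma(i+\nu+1)}\left(\frac{x}{2}\right)^{2i+\nu}$, equivalently $J_\nu(x)=\frac{x^\nu}{2^\nu\Gamma(\nu+1)}\prod_{i=1}^\infty\left(1-\frac{x^2}{j_{\nu,i}^2}\right)$, where $j_{\nu,1}<j_{\nu,2}<\dots$ are its positive zeros. *)

(* Defs.v *)
(* Stdlib real numbers, with Coquelicot for improper integrals and series. *)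
From Stdlib Require Export Arith Reals.
From Coquelicot Require Export Coquelicot.
Open Scope R_scope.

(* Euler's integral over (0, +oo).  It represents the Gamma function only for
   x > 0; for x <= 0 it diverges and the value is meaningless. *)
Definition Gamma (x : R) : R :=
  RInt_gen (fun t : R => Rpower t (x - 1) * exp (- t))
    (at_right 0) (Rbar_locally p_infty).

(* Meaningful for nu > -1 and x > 0: then every argument of Gamma is positive
   and Rpower, which is exp (y * ln x), is the genuine real power. *)
Definition BesselJ (nu x : R) : R :=
  Series (fun i : nat =>
    (-1) ^ i / (INR (fact i) * Gamma (INR i + nu + 1))
    * Rpower (x / 2) (2 * INR i + nu)).

Definition is_least_positive_zero (f : R -> R) (j : R) : Prop :=
  (0 < j /\ f j = 0) /\ (forall x : R, 0 < x -> f x = 0 -> j <= x).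

(* Main.v *)
Require Import Defs.
From Stdlib Require Import Lra Lia.

(** Write [m = nu + 1/2]; the claim is [j > (m^(2/3) + 1)^(3/2)].

    Let [s = J_(nu+1) / J_nu] on [(0, j)].  It is, up to sign, the logarithmic
    derivative of the even entire function [x^(-nu) J_nu(x)], whose zeros are
    all real, so [s'(x)] is the sum of [1 / (x - z)^2] over all these zeros [z];
    keeping the zero [j] alone gives [s'(x) > 1 / (j - x)^2].  On the other hand
    Bessel's equation is the Riccati equation [s' = s^2 - 2 m s / x + 1], so at a
    point [x] where [s(x) = m / x], which exists since [s] is small near [0] and
    tends to [+oo] at [j], one has [s'(x) = 1 - (m/x)^2].  Hence, with
    [cos t = m / x],
      [j > x + 1 / sin t = m / cos t + 1 / sin t >= (m^(2/3) + 1)^(3/2)],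
    the last step being the classical minimum of [m / cos t + 1 / sin t].

    The product formula, and with it the reality of the zeros, can be bypassed.
    The three-term recurrence of [k |-> J_(nu+k)] yields the
    Christoffel-Darboux identity
      [x y (J_(nu+1)(x) J_nu(y) - J_nu(x) J_(nu+1)(y)) / (x - y)
         = sum over k >= 1 of 2 (nu+k) J_(nu+k)(x) J_(nu+k)(y)],
    whose diagonal value is [x^2 J_nu(x)^2 s'(x)] by the Riccati equation.  The
    Cauchy-Schwarz inequality between the points [x] and [y = j] is then exactly
    [s'(x) >= 1 / (j - x)^2], and it is strict because sequences obeying the
    recurrence at two different points are not proportional.  This is
    [first_zero_dominates]; [balance_point] provides [x], and [corner_bound] is
    the final minimization.

    For the recurrence and the decay in [k] the coefficients of the series are
    needed, that is, the functional equation and the positivity of Euler's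
    integral: [Gamma_succ] and [Gamma_pos]. *)

(** * Euler's integral *)

(** Proper integrals of a nonnegative function increase with the interval, so
    they converge to their supremum as soon as they are bounded. *)
Lemma is_RInt_gen_bounded (f : R -> R) (M : R) :
  (forall t, 0 < t -> 0 <= f t) ->
  (forall a b, 0 < a -> a <= b -> ex_RInt f a b) ->
  (forall a b, 0 < a -> a <= b -> RInt f a b <= M) ->
  exists l, is_RInt_gen f (at_right 0) (Rbar_locally p_infty) l /\
    (forall a b, 0 < a -> a <= b -> RInt f a b <= l).
Proof.
  intros Hpos Hex HM.
  destruct (completeness
    (fun v => exists a b, (0 < a /\ a <= b) /\ v = RInt f a b)) as [l [Hub Hleast]].
  - exists M. intros v (a & b & [Ha Hab] & ->). now apply HM.
  - exists (RInt f 1 1), 1, 1. split; [lra | reflexivity].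
  - exists l.
    assert (Hle : forall a b, 0 < a -> a <= b -> RInt f a b <= l).
    { intros a b Ha Hab. apply Hub. exists a, b. now split. }
    split; [| exact Hle].
    intros P [eps HP].
    assert (Hnear : exists a0 b0, (0 < a0 /\ a0 <= b0) /\ l - eps < RInt f a0 b0).
    { apply Classical_Prop.NNPP. intros Hno.
      assert (l <= l - eps); [| destruct eps; simpl in *; lra].
      apply Hleast. intros v (a & b & Hab & ->).
      apply Rnot_lt_le. intros Hlt. apply Hno. exists a, b. now split. }
    destruct Hnear as (a0 & b0 & [Ha0 Hab0] & Hl0).
    apply Filter_prod with (Q := fun a => 0 < a < a0) (R := fun b => b0 < b).
    + exists (mkposreal a0 Ha0). intros y Hy Hy0.
      unfold ball in Hy; simpl in Hy; unfold AbsRing_ball, abs, minus, plus, opp in Hy;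
        simpl in Hy.
      apply Rabs_def2 in Hy. lra.
    + exists b0. now intros x.
    + intros a b [Ha Haa0] Hb. exists (RInt f a b). split.
      * apply (RInt_correct (V := R_CompleteNormedModule)), Hex; simpl; lra.
      * apply HP.
        assert (Hmono : RInt f a0 b0 <= RInt f a b).
        { rewrite <- (RInt_Chasles f a a0 b) by (apply Hex; lra).
          rewrite <- (RInt_Chasles f a0 b0 b) by (apply Hex; lra).
          unfold plus; simpl.
          assert (0 <= RInt f a a0).
          { apply RInt_ge_0; [lra | apply Hex; lra | intros; apply Hpos; lra]. }
          assert (0 <= RInt f b0 b).
          { apply RInt_ge_0; [lra | apply Hex; lra | intros; apply Hpos; lra]. }
          lra. }
        assert (RInt f a b <= l) by (apply Hle; lra).
        unfold ball; simpl; unfold AbsRing_ball, abs, minus, plus, opp; simpl.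
        apply Rabs_def1; lra.
Qed.

(** Half of the exponential decay absorbs the power, since
    [ln t <= ln (2 x) + t / (2 x)].  The single bound serves at both ends of
    [(0, +oo)]. *)
Lemma Rpower_exp_le (x : R) : 0 < x ->
  exists C, 0 < C /\
    forall t, 0 < t -> Rpower t x * exp (- t) <= C * exp (- (t / 2)).
Proof.
  intros Hx. exists (exp (x * ln (2 * x))). split; [apply exp_pos |].
  intros t Ht. unfold Rpower. rewrite <- !exp_plus.
  assert (Hln : ln t <= ln (2 * x) + t / (2 * x)).
  { assert (Hu : 0 < t / (2 * x)) by (apply Rdiv_lt_0_compat; lra).
    replace t with (2 * x * (t / (2 * x))) at 1 by (field; lra).
    rewrite ln_mult by lra.
    pose proof (exp_ineq1_le (ln (t / (2 * x)))) as He.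
    rewrite exp_ln in He by lra. lra. }
  apply (Rmult_le_compat_l x) in Hln; [| lra].
  replace (x * (ln (2 * x) + t / (2 * x))) with (x * ln (2 * x) + t / 2) in Hln
    by (field; lra).
  destruct (Rle_lt_or_eq_dec _ _ Hln) as [Hlt | Heq].
  - left. apply exp_increasing. lra.
  - right. f_equal. lra.
Qed.

Lemma is_derive_euler (x t : R) : 0 < t ->
  is_derive (fun t => Rpower t x * exp (- t)) t
    (x * (Rpower t (x - 1) * exp (- t)) - Rpower t x * exp (- t)).
Proof.
  intros Ht.
  assert (E : Rpower t x = Rpower t (x - 1) * t).
  { replace x with (x - 1 + 1) at 1 by ring. rewrite Rpower_plus, Rpower_1; auto. }
  unfold Rpower at 1. auto_derive; [lra |].
  fold (Rpower t x). rewrite E. field. lra.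
Qed.

Lemma continuous_euler (x t : R) : 0 < t ->
  continuous (fun t => Rpower t x * exp (- t)) t.
Proof.
  intros Ht. apply (ex_derive_continuous (V := R_NormedModule)).
  eexists. now apply is_derive_euler.
Qed.

(** By parts, [x t^(x-1) e^(-t)] is the derivative of [t^x e^(-t)] plus
    [t^x e^(-t)], and the latter is at most [C e^(-t/2)].  Thus the integrand
    lies below the derivative of a bounded function, with no need to split the
    half-line according to the two singular ends. *)
Lemma Gamma_correct (x : R) : 0 < x ->
  is_RInt_gen (fun t => Rpower t (x - 1) * exp (- t))
    (at_right 0) (Rbar_locally p_infty) (Gamma x) /\ 0 < Gamma x.
Proof.
  intros Hx.
  set (f := fun t => Rpower t (x - 1) * exp (- t)).
  assert (Hpos : forall t, 0 < t -> 0 < f t).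
  { intros t _. unfold f, Rpower. apply Rmult_lt_0_compat; apply exp_pos. }
  assert (Hex : forall a b, 0 < a -> a <= b -> ex_RInt f a b).
  { intros a b Ha Hab. apply (ex_RInt_continuous (V := R_CompleteNormedModule)).
    intros t Ht. rewrite Rmin_left in Ht by lra. apply continuous_euler. lra. }
  destruct (Rpower_exp_le x Hx) as (C & HC & Hdom).
  set (G := fun t => (Rpower t x * exp (- t) - 2 * C * exp (- (t / 2))) / x).
  set (dG := fun t =>
    (x * f t - Rpower t x * exp (- t) + C * exp (- (t / 2))) / x).
  assert (HG : forall t, 0 < t -> is_derive G t (dG t)).
  { intros t Ht. unfold G, dG.
    apply (is_derive_ext (fun t =>
      / x * (Rpower t x * exp (- t)) + - (2 * C / x) * exp (- (t / 2)))).
    { intros s.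
      change (/ x * (Rpower s x * exp (- s)) + - (2 * C / x) * exp (- (s / 2))
        = (Rpower s x * exp (- s) - 2 * C * exp (- (s / 2))) / x).
      field. lra. }
    replace ((x * f t - Rpower t x * exp (- t) + C * exp (- (t / 2))) / x)
      with (/ x * (x * f t - Rpower t x * exp (- t))
            + - (2 * C / x) * (- (1 / 2) * exp (- (t / 2)))) by (field; lra).
    apply (is_derive_plus (V := R_NormedModule)).
    - apply is_derive_scal. now apply is_derive_euler.
    - apply is_derive_scal. auto_derive; [trivial |]. unfold Rdiv. ring. }
  assert (HdG : forall t, 0 < t -> continuous dG t).
  { intros t Ht. unfold dG.
    apply (continuous_mult (K := R_AbsRing)); [| apply continuous_const].
    apply (continuous_plus (V := R_NormedModule)).
    - apply (continuous_minus (V := R_NormedModule)).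
      + apply (continuous_mult (K := R_AbsRing)); [apply continuous_const |].
        now apply continuous_euler.
      + now apply continuous_euler.
    - apply (ex_derive_continuous (V := R_NormedModule)). auto_derive. trivial. }
  assert (HM : forall a b, 0 < a -> a <= b -> RInt f a b <= 3 * C / x).
  { intros a b Ha Hab.
    assert (HI : is_RInt dG a b (G b - G a)).
    { apply (is_RInt_derive (V := R_CompleteNormedModule));
        intros t Ht; rewrite Rmin_left in Ht by lra; [apply HG | apply HdG]; lra. }
    apply Rle_trans with (RInt dG a b).
    - apply RInt_le; [lra | now apply Hex | eexists; exact HI |].
      intros t Ht. unfold dG.
      replace (f t) with (x * f t / x) at 1 by (field; lra).
      apply Rmult_le_compat_r; [left; apply Rinv_0_lt_compat; lra |].
      specialize (Hdom t). lra.
    - rewrite (is_RInt_unique _ _ _ _ HI). unfold G, Rdiv.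
      rewrite <- Rmult_minus_distr_r.
      apply Rmult_le_compat_r; [left; apply Rinv_0_lt_compat; lra |].
      assert (He : forall t, 0 < t -> exp (- (t / 2)) <= 1).
      { intros t Ht. rewrite <- exp_0. left. apply exp_increasing. lra. }
      assert (0 < Rpower a x * exp (- a))
        by (apply Rmult_lt_0_compat; apply exp_pos).
      pose proof (Hdom b). pose proof (He b). pose proof (He a).
      pose proof (exp_pos (- (b / 2))). nra. }
  destruct (is_RInt_gen_bounded f (3 * C / x)) as (l & Hl & Hle);
    [intros; left; auto | exact Hex | exact HM |].
  assert (E : Gamma x = l).
  { exact (is_RInt_gen_unique (V := R_CompleteNormedModule) f l Hl). }
  rewrite E. split; [exact Hl |].
  apply Rlt_le_trans with (RInt f 1 2); [| apply Hle; lra].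
  apply RInt_gt_0; [lra | intros; apply Hpos; lra |].
  intros t Ht. apply continuous_euler. lra.
Qed.

Lemma Gamma_pos (x : R) : 0 < x -> 0 < Gamma x.
Proof. intros Hx. now apply Gamma_correct. Qed.

(** Integration by parts; the boundary term [B t = t^x e^(-t)] vanishes at both
    ends. *)
Lemma Gamma_succ (x : R) : 0 < x -> Gamma (x + 1) = x * Gamma x.
Proof.
  intros Hx.
  set (B := fun t => Rpower t x * exp (- t)).
  assert (H0 : filterlim B (at_right 0) (locally 0)).
  { apply (filterlim_ext_loc (fun t => exp (x * ln t - t))).
    { apply filter_forall. intros t. unfold B, Rpower. rewrite <- exp_plus. f_equal. }
    apply (filterlim_comp _ _ _ (fun t => x * ln t - t) exp _ (Rbar_locally m_infty));
      [| exact is_lim_exp_m].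
    apply (filterlim_le_m_infty (fun t => x * ln t)).
    - exists (mkposreal 1 Rlt_0_1). intros t _ Ht. lra.
    - apply (filterlim_comp _ _ _ ln (fun u => x * u) _ (Rbar_locally m_infty));
        [exact is_lim_ln_0 |].
      intros P [M HP]. exists (M / x). intros u Hu. apply HP.
      apply (Rmult_lt_compat_l x) in Hu; [| lra].
      replace (x * (M / x)) with M in Hu by (field; lra). exact Hu. }
  assert (Hinf : filterlim B (Rbar_locally p_infty) (locally 0)).
  { destruct (Rpower_exp_le x Hx) as (C & HC & Hdom).
    apply (filterlim_le_le (fun _ => 0) B (fun t => C * exp (- (t / 2))) 0).
    - exists 0. intros t Ht. split; [| now apply Hdom].
      left. apply Rmult_lt_0_compat; apply exp_pos.
    - apply filterlim_const.
    - change (is_lim (fun t => C * exp (- (t / 2))) p_infty 0).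
      replace (Finite 0) with (Rbar_mult C 0) by (simpl; f_equal; ring).
      apply is_lim_scal_l.
      apply (is_lim_comp exp (fun t => - (t / 2)) p_infty 0 m_infty).
      + exact is_lim_exp_m.
      + intros P [M HP]. exists (- 2 * M). intros t Ht. apply HP. lra.
      + exists 0. discriminate. }
  (* An interval with both ends near 0+ and +oo lies in (0, +oo). *)
  assert (Hev : forall P : R -> Prop, (forall t, 0 < t -> P t) ->
    filter_prod (at_right 0) (Rbar_locally p_infty)
      (fun ab => forall t, Rmin (fst ab) (snd ab) <= t <= Rmax (fst ab) (snd ab) -> P t)).
  { intros P HP.
    apply Filter_prod with (Q := fun a => 0 < a) (R := fun b => 0 < b).
    - exists (mkposreal 1 Rlt_0_1). now intros.
    - now exists 0.
    - intros a b Ha Hb t [Ht _]. apply HP. simpl in Ht.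
      eapply Rlt_le_trans; [| exact Ht]. now apply Rmin_case. }
  assert (HD : forall t, 0 < t ->
    Derive B t = x * (Rpower t (x - 1) * exp (- t)) - B t).
  { intros t Ht. apply is_derive_unique. now apply is_derive_euler. }
  assert (HI : is_RInt_gen (Derive B) (at_right 0) (Rbar_locally p_infty) (0 - 0)).
  { apply is_RInt_gen_Derive; try typeclasses eauto; try assumption; apply Hev;
      intros t Ht.
    - eexists. now apply is_derive_euler.
    - apply (continuous_ext_loc _
        (fun t => x * (Rpower t (x - 1) * exp (- t)) - B t)).
      + exists (mkposreal t Ht). intros s Hs. symmetry. apply HD.
        unfold ball in Hs; simpl in Hs;
          unfold AbsRing_ball, abs, minus, plus, opp in Hs; simpl in Hs.
        apply Rabs_def2 in Hs. lra.
      + apply (continuous_minus (V := R_NormedModule)).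
        * apply (continuous_mult (K := R_AbsRing)); [apply continuous_const |].
          now apply continuous_euler.
        * now apply continuous_euler. }
  destruct (Gamma_correct x Hx) as [HG _].
  apply (is_RInt_gen_unique (V := R_CompleteNormedModule)
    (fun t => Rpower t (x + 1 - 1) * exp (- t))).
  replace (x * Gamma x) with (minus (scal x (Gamma x)) (0 - 0) : R)
    by (unfold minus, scal, plus, opp; simpl; unfold mult; simpl; ring).
  apply (is_RInt_gen_ext
    (fun t => minus (scal x (Rpower t (x - 1) * exp (- t))) (Derive B t))).
  - eapply filter_imp; [| apply (Hev (fun t => 0 < t)); auto].
    intros ab Hab t Ht. rewrite HD by (apply Hab; lra).
    unfold B. replace (x + 1 - 1) with x by ring.
    unfold minus, scal, plus, opp; simpl; unfold mult; simpl. ring.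
  - refine (is_RInt_gen_minus (V := R_NormedModule)
      (fun t => scal x (Rpower t (x - 1) * exp (- t))) (Derive B) _ _ _ HI).
    exact (is_RInt_gen_scal (V := R_NormedModule) _ x _ HG).
Qed.

(** * The power series of Bessel functions *)

Definition bessel_coef (nu : R) (i : nat) : R :=
  (-1) ^ i / (INR (fact i) * Gamma (INR i + nu + 1)).

(** [J_nu(x) = (x/2)^nu besselF nu ((x/2)^2)]: an entire function of
    [z = (x/2)^2], free of the singular factor. *)
Definition besselF (nu z : R) : R := PSeries (bessel_coef nu) z.

Lemma BesselJ_besselF (nu x : R) : 0 < x ->
  BesselJ nu x = Rpower (x / 2) nu * besselF nu ((x / 2) ^ 2).
Proof.
  intros Hx. unfold BesselJ, besselF, PSeries. rewrite <- Series_scal_l.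
  apply Series_ext. intros i. fold (bessel_coef nu i).
  rewrite Rpower_plus.
  replace (2 * INR i) with (INR (2 * i)) by (rewrite mult_INR; simpl; ring).
  rewrite Rpower_pow by lra. rewrite pow_mult. ring.
Qed.

Lemma Gamma_le_shift (s : R) (i : nat) : 1 <= s -> Gamma s <= Gamma (INR i + s).
Proof.
  intros Hs. induction i as [| i IH]; [simpl; rewrite Rplus_0_l; lra |].
  pose proof (pos_INR i). rewrite S_INR.
  replace (INR i + 1 + s) with (INR i + s + 1) by ring.
  rewrite Gamma_succ by lra.
  assert (0 < Gamma (INR i + s)) by (apply Gamma_pos; lra). nra.
Qed.

Lemma fact_pos (n : nat) : 0 < INR (fact n).
Proof. apply lt_0_INR, lt_O_fact. Qed.

Lemma bessel_coef_neq_0 (nu : R) (i : nat) : -1 < nu -> bessel_coef nu i <> 0.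
Proof.
  intros Hnu. pose proof (pos_INR i). pose proof (fact_pos i).
  assert (0 < Gamma (INR i + nu + 1)) by (apply Gamma_pos; lra).
  unfold bessel_coef, Rdiv. apply Rmult_integral_contrapositive_currified.
  - apply pow_nonzero. lra.
  - apply Rinv_neq_0_compat. nra.
Qed.

Lemma bessel_coef_succ (nu : R) (i : nat) : -1 < nu ->
  INR (S i) * bessel_coef nu (S i) = - bessel_coef (nu + 1) i.
Proof.
  intros Hnu. pose proof (pos_INR i). pose proof (fact_pos i).
  unfold bessel_coef. rewrite fact_simpl, mult_INR, S_INR.
  replace (INR i + 1 + nu + 1) with (INR i + (nu + 1) + 1) by ring.
  assert (0 < Gamma (INR i + (nu + 1) + 1)) by (apply Gamma_pos; lra).
  simpl pow. field. lra.
Qed.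

Lemma bessel_coef_rec (nu : R) (i : nat) : -1 < nu ->
  bessel_coef nu i = (INR i + nu + 1) * bessel_coef (nu + 1) i.
Proof.
  intros Hnu. pose proof (pos_INR i). pose proof (fact_pos i).
  unfold bessel_coef.
  replace (INR i + (nu + 1) + 1) with (INR i + nu + 1 + 1) by ring.
  rewrite (Gamma_succ (INR i + nu + 1)) by lra.
  assert (0 < Gamma (INR i + nu + 1)) by (apply Gamma_pos; lra).
  field. lra.
Qed.

Lemma CV_radius_bessel (nu : R) : -1 < nu -> CV_radius (bessel_coef nu) = p_infty.
Proof.
  intros Hnu. apply CV_radius_infinite_DAlembert.
  - intros i. now apply bessel_coef_neq_0.
  - apply (is_lim_seq_le_le (fun _ => 0) _ (fun i => / (nu + 1) * / (INR i + 1))).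
    + intros i. split; [apply Rabs_pos |].
      pose proof (pos_INR i).
      pose proof (bessel_coef_neq_0 (nu + 1) i ltac:(lra)) as Hn.
      pose proof (bessel_coef_succ nu i Hnu) as E. rewrite S_INR in E.
      rewrite (bessel_coef_rec nu i Hnu).
      replace (bessel_coef nu (S i)) with (- bessel_coef (nu + 1) i / (INR i + 1))
        by (rewrite <- E; field; lra).
      replace (- bessel_coef (nu + 1) i / (INR i + 1)
        / ((INR i + nu + 1) * bessel_coef (nu + 1) i))
        with (- (/ (INR i + nu + 1) * / (INR i + 1))) by (field; repeat split; lra).
      rewrite Rabs_Ropp, Rabs_right.
      * apply Rmult_le_compat_r; [left; apply Rinv_0_lt_compat; lra |].
        apply Rinv_le_contravar; lra.
      * apply Rle_ge, Rmult_le_pos; left; apply Rinv_0_lt_compat; lra.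
    + apply is_lim_seq_const.
    + replace (Finite 0) with (Rbar_mult (/ (nu + 1)) 0) by (simpl; f_equal; ring).
      apply is_lim_seq_scal_l.
      apply (is_lim_seq_ext (fun i => / INR (S i))); [intros; now rewrite S_INR |].
      apply (is_lim_seq_incr_1 (fun i => / INR i)).
      replace (Finite 0) with (Rbar_inv p_infty) by reflexivity.
      apply is_lim_seq_inv; [apply is_lim_seq_INR | discriminate].
Qed.

Lemma ex_pseries_bessel (nu z : R) : -1 < nu -> ex_pseries (bessel_coef nu) z.
Proof. intros Hnu. apply CV_radius_inside. now rewrite CV_radius_bessel. Qed.

(** This is the rule [(x^(-nu) J_nu)' = - x^(-nu) J_(nu+1)] in the variable
    [z]. *)
Lemma is_derive_besselF (nu z : R) : -1 < nu ->
  is_derive (besselF nu) z (- besselF (nu + 1) z).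
Proof.
  intros Hnu. unfold besselF. rewrite <- PSeries_opp.
  rewrite <- (PSeries_ext (PS_derive (bessel_coef nu))).
  - apply is_derive_PSeries. now rewrite CV_radius_bessel.
  - intros i. unfold PS_derive, PS_opp. now apply bessel_coef_succ.
Qed.

Lemma besselF_rec (nu z : R) : -1 < nu ->
  besselF nu z = (nu + 1) * besselF (nu + 1) z - z * besselF (nu + 2) z.
Proof.
  intros Hnu. unfold besselF.
  rewrite <- PSeries_incr_1, <- PSeries_scal, <- PSeries_minus.
  - apply PSeries_ext. intros [| i]; unfold PS_minus, PS_plus, PS_scal, PS_opp,
      PS_incr_1; rewrite bessel_coef_rec by exact Hnu;
      unfold plus, opp, scal, zero; simpl; unfold mult; simpl.
    + ring.
    + change (match i with O => 1 | S _ => INR i + 1 end) with (INR (S i)).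
      pose proof (bessel_coef_succ (nu + 1) i ltac:(lra)) as E.
      replace (nu + 1 + 1) with (nu + 2) in E by ring.
      rewrite <- E. ring.
  - apply ex_pseries_scal; [apply Rmult_comm | apply ex_pseries_bessel; lra].
  - apply ex_pseries_incr_1, ex_pseries_bessel. lra.
Qed.

Lemma besselF_0_pos (nu : R) : -1 < nu -> 0 < besselF nu 0.
Proof.
  intros Hnu. unfold besselF. rewrite PSeries_0. unfold bessel_coef. simpl.
  assert (0 < Gamma (0 + nu + 1)) by (apply Gamma_pos; lra).
  apply Rdiv_lt_0_compat; lra.
Qed.

(** For [nu >= 0] every Gamma factor is at least the first one, so the series is
    dominated by that of the exponential. *)
Lemma besselF_bound (nu z : R) : 0 <= nu -> 0 <= z ->
  Rabs (besselF nu z) <= exp z / Gamma (nu + 1).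
Proof.
  intros Hnu Hz.
  assert (HG : 0 < Gamma (nu + 1)) by (apply Gamma_pos; lra).
  pose proof (is_exp_Reals z) as He. apply is_pseries_R in He.
  assert (Hs : is_series (fun i => / Gamma (nu + 1) * (/ INR (fact i) * z ^ i))
                         (/ Gamma (nu + 1) * exp z)).
  { exact (is_series_scal_l (/ Gamma (nu + 1)) _ _ He). }
  assert (Hle : forall i, 0 <= Rabs (bessel_coef nu i * z ^ i)
    <= / Gamma (nu + 1) * (/ INR (fact i) * z ^ i)).
  { intros i. split; [apply Rabs_pos |].
    pose proof (pos_INR i). pose proof (fact_pos i).
    pose proof (Gamma_le_shift (nu + 1) i ltac:(lra)) as Hm.
    rewrite <- Rplus_assoc in Hm.
    unfold bessel_coef, Rdiv. rewrite !Rabs_mult, pow_1_abs, Rmult_1_l.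
    rewrite (Rabs_right (z ^ i)) by (apply Rle_ge, pow_le; lra).
    rewrite Rabs_right by (apply Rle_ge; left; apply Rinv_0_lt_compat; nra).
    rewrite <- Rmult_assoc. apply Rmult_le_compat_r; [now apply pow_le |].
    rewrite <- Rinv_mult. apply Rinv_le_contravar; nra. }
  unfold besselF, PSeries.
  replace (exp z / Gamma (nu + 1)) with (/ Gamma (nu + 1) * exp z)
    by (unfold Rdiv; ring).
  rewrite <- (is_series_unique _ _ Hs).
  apply Rle_trans with (Series (fun i => Rabs (bessel_coef nu i * z ^ i))).
  - apply Series_Rabs. apply CV_disk_inside. rewrite CV_radius_bessel; [easy | lra].
  - apply Series_le; [exact Hle | eexists; exact Hs].
Qed.

Lemma Gamma_ge_fact (nu : R) (k : nat) : -1 < nu ->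
  Gamma (nu + 2) * INR (fact k) <= Gamma (nu + INR (S k) + 1).
Proof.
  intros Hnu. assert (HG : 0 < Gamma (nu + 2)) by (apply Gamma_pos; lra).
  induction k as [| k IH].
  - simpl. replace (nu + 1 + 1) with (nu + 2) by ring. lra.
  - rewrite S_INR, fact_simpl, mult_INR.
    pose proof (pos_INR (S k)). pose proof (fact_pos k).
    replace (nu + (INR (S k) + 1) + 1) with (nu + INR (S k) + 1 + 1) by ring.
    rewrite Gamma_succ by lra.
    replace (Gamma (nu + 2) * (INR (S k) * INR (fact k)))
      with (INR (S k) * (Gamma (nu + 2) * INR (fact k))) by ring.
    apply Rmult_le_compat; [lra | nra | lra | exact IH].
Qed.

(** [J_(nu+k)(x) / (x/2)^nu].  The factor [(x/2)^nu] does not depend on [k], so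
    these numbers obey the recurrence of [k |-> J_(nu+k)(x)]. *)
Definition besselP (nu x : R) (k : nat) : R :=
  (x / 2) ^ k * besselF (nu + INR k) ((x / 2) ^ 2).

Lemma besselP_rec (nu x : R) (k : nat) : -1 < nu -> 0 < x ->
  besselP nu x k + besselP nu x (S (S k))
  = 2 * (nu + INR k + 1) / x * besselP nu x (S k).
Proof.
  intros Hnu Hx. pose proof (pos_INR k). unfold besselP. rewrite !S_INR.
  rewrite (besselF_rec (nu + INR k)) by lra.
  replace (nu + (INR k + 1)) with (nu + INR k + 1) by ring.
  replace (nu + (INR k + 1 + 1)) with (nu + INR k + 2) by ring.
  simpl pow. field. lra.
Qed.

Lemma INR_le_pow2 (k : nat) : INR k + 1 <= 2 ^ k.
Proof.
  induction k as [| k IH]; [simpl; lra |]. rewrite S_INR. simpl pow.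
  pose proof (pos_INR k). lra.
Qed.

(** [|besselP nu x k|] is at most a constant times
    [(x/2)^k / (k-1)!], while [k + 1 <= 2 * 2^(k-1)]. *)
Lemma besselP_lim (nu x : R) : -1 < nu -> 0 < x ->
  is_lim_seq (fun k => INR (S k) * besselP nu x k) 0.
Proof.
  intros Hnu Hx.
  assert (HG : 0 < Gamma (nu + 2)) by (apply Gamma_pos; lra).
  set (K := 2 * (x / 2) * exp ((x / 2) ^ 2) / Gamma (nu + 2)).
  apply is_lim_seq_incr_1, is_lim_seq_abs_0.
  apply (is_lim_seq_le_le (fun _ => 0) _ (fun k => K * (x ^ k / INR (fact k)))).
  - intros k. split; [apply Rabs_pos |].
    pose proof (pos_INR k). pose proof (fact_pos k).
    assert (Hx2 : 0 < (x / 2) ^ k) by (apply pow_lt; lra).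
    pose proof (besselF_bound (nu + INR (S k)) ((x / 2) ^ 2)
      ltac:(rewrite S_INR; lra) ltac:(apply pow2_ge_0)) as HF.
    pose proof (Gamma_ge_fact nu k Hnu) as Hfact.
    pose proof (exp_pos ((x / 2) ^ 2)).
    assert (HF' : Rabs (besselF (nu + INR (S k)) ((x / 2) ^ 2))
      <= exp ((x / 2) ^ 2) * / (Gamma (nu + 2) * INR (fact k))).
    { eapply Rle_trans; [exact HF |]. apply Rmult_le_compat_l; [lra |].
      apply Rinv_le_contravar; nra. }
    assert (Hpow : INR (S (S k)) * (x / 2) ^ S k <= 2 * (x / 2) * x ^ k).
    { replace (x ^ k) with (2 ^ k * (x / 2) ^ k)
        by (rewrite <- Rpow_mult_distr; f_equal; field).
      rewrite !S_INR. simpl pow. pose proof (INR_le_pow2 k).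
      replace ((INR k + 1 + 1) * (x / 2 * (x / 2) ^ k))
        with ((INR k + 1 + 1) * (x / 2) * (x / 2) ^ k) by ring.
      replace (2 * (x / 2) * (2 ^ k * (x / 2) ^ k))
        with (2 * (x / 2) * 2 ^ k * (x / 2) ^ k) by ring.
      apply Rmult_le_compat_r; nra. }
    unfold besselP. rewrite <- Rmult_assoc, Rabs_mult.
    rewrite (Rabs_right (INR (S (S k)) * (x / 2) ^ S k))
      by (apply Rle_ge, Rmult_le_pos; [apply pos_INR | apply pow_le; lra]).
    replace (K * (x ^ k / INR (fact k))) with
      (2 * (x / 2) * x ^ k * (exp ((x / 2) ^ 2) * / (Gamma (nu + 2) * INR (fact k))))
      by (unfold K; field; lra).
    apply Rmult_le_compat; [| apply Rabs_pos | exact Hpow | exact HF'].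
    apply Rmult_le_pos; [apply pos_INR | apply pow_le; lra].
  - apply is_lim_seq_const.
  - replace (Finite 0) with (Rbar_mult K 0) by (simpl; f_equal; ring).
    apply is_lim_seq_scal_l. apply is_lim_seq_Reals, cv_speed_pow_fact.
Qed.

(** * Positivity up to the first zero *)

Lemma continuous_besselF (nu z : R) : -1 < nu -> continuous (besselF nu) z.
Proof.
  intros Hnu. apply (ex_derive_continuous (V := R_NormedModule)).
  eexists. now apply is_derive_besselF.
Qed.

Lemma besselF_mvt (nu a b : R) : -1 < nu -> a < b ->
  exists c, a <= c <= b /\
    besselF nu b - besselF nu a = - besselF (nu + 1) c * (b - a).
Proof.
  intros Hnu Hab.
  destruct (MVT_gen (besselF nu) a b (fun z => - besselF (nu + 1) z))
    as (c & Hc & E).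
  - intros z _. now apply is_derive_besselF.
  - intros z _. apply continuity_pt_filterlim. now apply continuous_besselF.
  - rewrite Rmin_left, Rmax_right in Hc by lra. now exists c.
Qed.

(** For a large order the value at 0, which is [1 / Gamma (nu + 1)], outweighs the
    variation [z * besselF (nu + 1) c] over [[0, z]]. *)
Lemma besselF_eventually_pos (nu z : R) : 0 <= nu -> 0 < z ->
  z * exp z < nu + 1 -> 0 < besselF nu z.
Proof.
  intros Hnu Hz Hlarge.
  destruct (besselF_mvt nu 0 z ltac:(lra) Hz) as (c & Hc & E).
  pose proof (besselF_bound (nu + 1) c ltac:(lra) ltac:(lra)) as HB.
  apply Rabs_le_between in HB.
  assert (HG : 0 < Gamma (nu + 1)) by (apply Gamma_pos; lra).
  rewrite (Gamma_succ (nu + 1)) in HB by lra.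
  assert (E0 : besselF nu 0 = / Gamma (nu + 1)).
  { unfold besselF. rewrite PSeries_0. unfold bessel_coef. simpl.
    rewrite Rplus_0_l. field. lra. }
  assert (Hexp : exp c <= exp z).
  { destruct (Rle_lt_or_eq_dec c z) as [Hlt | ->]; [lra | | lra].
    left. now apply exp_increasing. }
  assert (Hprod : exp c / ((nu + 1) * Gamma (nu + 1)) * z < / Gamma (nu + 1)).
  { apply (Rmult_lt_reg_r ((nu + 1) * Gamma (nu + 1))); [nra |].
    replace (exp c / ((nu + 1) * Gamma (nu + 1)) * z * ((nu + 1) * Gamma (nu + 1)))
      with (z * exp c) by (field; lra).
    replace (/ Gamma (nu + 1) * ((nu + 1) * Gamma (nu + 1))) with (nu + 1)
      by (field; lra).
    nra. }
  nra.
Qed.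

(** The recurrence would propagate a common zero to all higher orders, but
    functions of large order do not vanish at [z]. *)
Lemma besselF_no_common_zero (nu z : R) : -1 < nu -> 0 < z ->
  besselF nu z = 0 -> besselF (nu + 1) z <> 0.
Proof.
  intros Hnu Hz H0 H1.
  assert (Hall : forall k,
    besselF (nu + INR k) z = 0 /\ besselF (nu + INR k + 1) z = 0).
  { induction k as [| k [IH0 IH1]]; [simpl; rewrite Rplus_0_r; now split |].
    pose proof (pos_INR k). rewrite S_INR, <- Rplus_assoc. split; [exact IH1 |].
    pose proof (besselF_rec (nu + INR k) z ltac:(lra)) as E.
    rewrite IH0, IH1 in E. replace (nu + INR k + 1 + 1) with (nu + INR k + 2) by ring.
    nra. }
  destruct (INR_unbounded (z * exp z + 1)) as [k Hk].
  pose proof (Rmult_lt_0_compat _ _ Hz (exp_pos z)).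
  pose proof (besselF_eventually_pos (nu + INR k) z ltac:(lra) Hz ltac:(lra)).
  destruct (Hall k). lra.
Qed.

Lemma besselF_before_first_zero (nu z1 : R) : -1 < nu -> 0 < z1 ->
  (forall z, 0 < z < z1 -> besselF nu z <> 0) ->
  forall z, 0 <= z < z1 -> 0 < besselF nu z.
Proof.
  intros Hnu Hz1 Hno z Hz. pose proof (besselF_0_pos nu Hnu) as H0.
  apply Rnot_le_lt. intros Hneg.
  destruct (IVT_gen (besselF nu) 0 z 0) as (c & Hc & E).
  - intros t. apply continuity_pt_filterlim. now apply continuous_besselF.
  - rewrite Rmin_right, Rmax_left by lra. lra.
  - rewrite Rmin_left, Rmax_right in Hc by lra.
    assert (c <> 0) by (intros ->; lra).
    apply (Hno c); [lra | exact E].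
Qed.

(** [besselF nu] is positive before its first zero, so its derivative
    [- besselF (nu + 1)] is at most [0] there, and it is not [0] because the two
    functions have no common zero. *)
Lemma besselF_succ_pos_at_first_zero (nu z1 : R) : -1 < nu -> 0 < z1 ->
  besselF nu z1 = 0 -> (forall z, 0 < z < z1 -> besselF nu z <> 0) ->
  0 < besselF (nu + 1) z1.
Proof.
  intros Hnu Hz1 E1 Hno.
  pose proof (besselF_no_common_zero nu z1 Hnu Hz1 E1) as Hne.
  apply Rnot_le_lt. intros Hle.
  assert (Hneg : besselF (nu + 1) z1 < 0) by lra.
  destruct (continuous_besselF (nu + 1) z1 ltac:(lra) (fun v => v < 0)) as [d Hd].
  { exact (open_lt 0 _ Hneg). }
  set (z := Rmax (z1 / 2) (z1 - d / 2)).
  assert (Hz : z1 / 2 <= z /\ z1 - d / 2 <= z)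
    by (split; [apply Rmax_l | apply Rmax_r]).
  pose proof (cond_pos d).
  assert (Hzlt : z < z1) by (apply Rmax_lub_lt; lra).
  destruct (besselF_mvt nu z z1 Hnu Hzlt) as (c & Hc & E).
  assert (Hcneg : besselF (nu + 1) c < 0).
  { apply Hd. change (Rabs (c - z1) < d). apply Rabs_def1; lra. }
  pose proof (besselF_before_first_zero nu z1 Hnu Hz1 Hno z ltac:(lra)).
  rewrite E1 in E. nra.
Qed.

(** In the variable [x = 2 sqrt z] the equation says
    [x J_(nu+1)(x) = (nu + 1/2) J_nu(x)], i.e. that [sqrt x * J_nu(x)] is
    stationary at [x]. *)
Lemma balance_point (nu z1 : R) : - (1 / 2) < nu -> 0 < z1 ->
  besselF nu z1 = 0 -> (forall z, 0 < z < z1 -> besselF nu z <> 0) ->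
  exists z, 0 < z < z1 /\ 2 * z * besselF (nu + 1) z = (nu + 1 / 2) * besselF nu z.
Proof.
  intros Hnu Hz1 E1 Hno.
  pose proof (besselF_succ_pos_at_first_zero nu z1 ltac:(lra) Hz1 E1 Hno) as HF1.
  pose proof (besselF_0_pos nu ltac:(lra)) as HF0.
  set (phi := fun z => 2 * z * besselF (nu + 1) z - (nu + 1 / 2) * besselF nu z).
  assert (P0 : phi 0 < 0) by (unfold phi; nra).
  assert (P1 : 0 < phi z1) by (unfold phi; rewrite E1; nra).
  destruct (IVT_gen phi 0 z1 0) as (z & Hz & E).
  - intros t. apply continuity_pt_filterlim. unfold phi.
    apply (continuous_minus (V := R_NormedModule)
      (fun z => 2 * z * besselF (nu + 1) z) (fun z => (nu + 1 / 2) * besselF nu z)).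
    + apply (continuous_mult (K := R_AbsRing) (fun z => 2 * z));
        [| apply continuous_besselF; lra].
      apply (continuous_mult (K := R_AbsRing) (fun _ => 2));
        [apply continuous_const | apply continuous_id].
    + apply (continuous_mult (K := R_AbsRing) (fun _ => nu + 1 / 2));
        [apply continuous_const | apply continuous_besselF; lra].
  - rewrite Rmin_left, Rmax_right by lra. lra.
  - rewrite Rmin_left, Rmax_right in Hz by lra.
    assert (z <> 0) by (intros ->; lra). assert (z <> z1) by (intros ->; lra).
    exists z. split; [lra |]. unfold phi in E. lra.
Qed.

(** * Cauchy-Schwarz inequality between two points *)

(** For [p k] and [q k] proportional to [J_(nu+k)(x)] and [J_(nu+k)(y)], with [y]
    a zero of [J_nu], this is the inequality [s'(x) > 1 / (y - x)^2] multiplied by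
    [x^2 p(0)^2], where [s = J_(nu+1) / J_nu].

    [T x p 0], [D 0] and [T y q 0] are the sums over [k >= 1] of
    [2 (nu+k) p(k)^2], [2 (nu+k) p(k) q(k)] and [2 (nu+k) q(k)^2], and [T], [D] at
    the index [k] are the corresponding tails.  So [V k] is a tail of the sum of
    [2 (nu+k) (p(k) - lam q(k))^2], and the positivity of [V 0] at the minimizing
    [lam] is the strict Cauchy-Schwarz inequality. *)
Lemma first_zero_dominates (nu x y : R) (p q : nat -> R)
  (hnu : -1 < nu) (hx : 0 < x) (hxy : x < y)
  (hp : forall k, p k + p (S (S k)) = 2 * (nu + INR k + 1) / x * p (S k))
  (hq : forall k, q k + q (S (S k)) = 2 * (nu + INR k + 1) / y * q (S k))
  (lp : is_lim_seq (fun k => INR (S k) * p k) 0)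
  (lq : is_lim_seq (fun k => INR (S k) * q k) 0)
  (hq0 : q 0%nat = 0) (hq1 : 0 < q 1%nat) (hp0 : 0 < p 0%nat) :
  (x * p 0%nat / (y - x)) ^ 2 <
  x ^ 2 * (p 0%nat ^ 2 + p 1%nat ^ 2) - (2 * nu + 1) * x * p 0%nat * p 1%nat.
Proof.
  set (T := fun (z : R) (u : nat -> R) k =>
    z ^ 2 * (u k ^ 2 + u (S k) ^ 2) - (2 * (nu + INR k) + 1) * z * u k * u (S k)).
  set (D := fun k => x * y * (p k * q (S k) - p (S k) * q k) / (y - x)).
  set (lam := D 0%nat / T y q 0%nat).
  set (V := fun k => T x p k - 2 * lam * D k + lam ^ 2 * T y q k).
  assert (HV : forall k, V k = V (S k)
    + 2 * (nu + INR k + 1) * (p (S k) - lam * q (S k)) ^ 2).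
  { intros k. unfold V, T, D.
    assert (Ep : p k = 2 * (nu + INR k + 1) / x * p (S k) - p (S (S k)))
      by (rewrite <- hp; ring).
    assert (Eq : q k = 2 * (nu + INR k + 1) / y * q (S k) - q (S (S k)))
      by (rewrite <- hq; ring).
    rewrite Ep, Eq, S_INR. field. lra. }
  assert (Hsq : forall k, 0 <= 2 * (nu + INR k + 1) * (p (S k) - lam * q (S k)) ^ 2).
  { intros k. pose proof (pos_INR k). pose proof (pow2_ge_0 (p (S k) - lam * q (S k))).
    apply Rmult_le_pos; lra. }
  assert (Hweak : forall u : nat -> R,
    is_lim_seq (fun k => INR (S k) * u k) 0 ->
    is_lim_seq u 0 /\ is_lim_seq (fun k => u (S k)) 0).
  { intros u Hu.
    assert (H0 : is_lim_seq u 0).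
    { apply is_lim_seq_abs_0 in Hu. apply is_lim_seq_abs_0.
      apply (is_lim_seq_le_le (fun _ => 0) _ (fun k => Rabs (INR (S k) * u k)));
        [| apply is_lim_seq_const | exact Hu].
      intros k. pose proof (Rabs_pos (u k)). split; [assumption |].
      rewrite Rabs_mult, (Rabs_right (INR (S k))) by (apply Rle_ge, pos_INR).
      rewrite S_INR. pose proof (pos_INR k). nra. }
    split; [exact H0 |]. now apply is_lim_seq_incr_1 in H0. }
  destruct (Hweak p lp) as [lp0 lp1]. destruct (Hweak q lq) as [lq0 lq1].
  assert (HT : forall (z : R) (u : nat -> R),
    is_lim_seq (fun k => INR (S k) * u k) 0 -> is_lim_seq (T z u) 0).
  { intros z u Hu. destruct (Hweak u Hu) as [Hu0 Hu1].
    apply (is_lim_seq_ext (fun k => z ^ 2 * (u k * u k + u (S k) * u (S k))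
      + (- 2 * z * (INR (S k) * u k) + (z * (1 - 2 * nu)) * u k) * u (S k))).
    { intros k. unfold T. rewrite S_INR. ring. }
    replace 0 with (z ^ 2 * (0 * 0 + 0 * 0)
      + (- 2 * z * 0 + (z * (1 - 2 * nu)) * 0) * 0) by ring.
    repeat first [ assumption | apply is_lim_seq_const
      | apply is_lim_seq_plus' | apply is_lim_seq_mult' ]. }
  assert (HVlim : is_lim_seq V 0).
  { apply (is_lim_seq_ext (fun k => T x p k
      + (- 2 * lam * (x * y / (y - x))) * (p k * q (S k) + (-1) * (p (S k) * q k))
      + lam ^ 2 * T y q k)).
    { intros k. unfold V, D. field. lra. }
    replace 0 with (0 + (- 2 * lam * (x * y / (y - x))) * (0 * 0 + (-1) * (0 * 0))
      + lam ^ 2 * 0) by ring.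
    repeat first [ assumption | apply HT; assumption | apply is_lim_seq_const
      | apply is_lim_seq_plus' | apply is_lim_seq_mult' ]. }
  (* V decreases to 0, so it is nonnegative; three steps back give V 0 > 0. *)
  assert (HV3 : 0 <= V 3%nat).
  { apply (is_lim_seq_decr_compare V 0 HVlim). intros k.
    rewrite (HV k). pose proof (Hsq k). lra. }
  assert (HT0 : T y q 0%nat = (y * q 1%nat) ^ 2) by (unfold T; rewrite hq0; ring).
  assert (HD0 : D 0%nat = x * p 0%nat / (y - x) * (y * q 1%nat)).
  { unfold D. rewrite hq0. field. lra. }
  assert (Hyq : 0 < y * q 1%nat) by nra.
  assert (Hlam : lam = x * p 0%nat / (y - x) / (y * q 1%nat)).
  { unfold lam. rewrite HD0, HT0. field. split; nra. }
  assert (Hr : 0 < x * p 0%nat / (y - x)) by (apply Rdiv_lt_0_compat; nra).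
  assert (Hlam0 : 0 < lam) by (rewrite Hlam; now apply Rdiv_lt_0_compat).
  (* Otherwise p and q are proportional at 1, 2, 3, and the recurrences at x
     and y, centred at 2, would force x = y. *)
  assert (HV0 : 0 < V 0%nat).
  { pose proof (Hsq 0%nat) as H1. pose proof (Hsq 1%nat) as H2.
    pose proof (Hsq 2%nat) as H3.
    pose proof (HV 0%nat) as E1. pose proof (HV 1%nat) as E2.
    pose proof (HV 2%nat) as E3.
    apply Rnot_le_lt. intros Hneg.
    assert (Hz : forall k, 2 * (nu + INR k + 1) * (p (S k) - lam * q (S k)) ^ 2 = 0 ->
      p (S k) = lam * q (S k)).
    { intros k Hk. pose proof (pos_INR k).
      apply Rmult_integral in Hk. destruct Hk as [Hk | Hk]; [lra |].
      simpl in Hk. rewrite Rmult_1_r in Hk. apply Rmult_integral in Hk. lra. }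
    pose proof (Hz 0%nat ltac:(lra)) as F1. pose proof (Hz 1%nat ltac:(lra)) as F2.
    pose proof (Hz 2%nat ltac:(lra)) as F3.
    pose proof (hp 1%nat) as Rp. pose proof (hq 1%nat) as Rq.
    pose proof (hq 0%nat) as Rq0. rewrite hq0, Rplus_0_l in Rq0.
    assert (Hq2 : 0 < q 2%nat).
    { rewrite Rq0. simpl INR. apply Rmult_lt_0_compat; [| exact hq1].
      apply Rdiv_lt_0_compat; lra. }
    rewrite F1, F2, F3, <- Rmult_plus_distr_l, Rq in Rp. simpl INR in Rp.
    assert (E : lam * q 2%nat * (nu + 2) * (y - x) = 0).
    { apply (f_equal (fun v => v * x * y / 2)) in Rp. field_simplify in Rp; lra. }
    assert (0 < lam * q 2%nat * (nu + 2) * (y - x)); [| lra].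
    apply Rmult_lt_0_compat; [| lra]. apply Rmult_lt_0_compat; [| lra].
    now apply Rmult_lt_0_compat. }
  assert (E : V 0%nat = T x p 0%nat - (x * p 0%nat / (y - x)) ^ 2).
  { unfold V. rewrite HD0, HT0, Hlam. field. split; nra. }
  rewrite E in HV0. unfold T in HV0. simpl INR in HV0.
  rewrite Rplus_0_r in HV0. lra.
Qed.

(** * The minimum of [m / cos t + 1 / sin t] *)

(** With [c = a^3 / x = cos t] and [s = sin t], the hypothesis says that
    [y > a^3 / c + 1 / s], which is minimal at [c = a / r], [s = 1 / r],
    [r = sqrt (a^2 + 1)].  Minimality follows from convexity of
    [v |-> v^(-1/2)]: at [v = c^2] and [v = s^2] the function lies above its
    tangents at the minimizer, and the two tangent bounds add up to a constant
    because [c^2 + s^2 = 1]. *)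
Lemma corner_bound (a x y : R) (ha : 0 < a) (hx : a ^ 3 < x) (hxy : x < y)
  (h : x ^ 2 < (x ^ 2 - (a ^ 3) ^ 2) * (y - x) ^ 2) :
  sqrt (a ^ 2 + 1) ^ 3 < y.
Proof.
  assert (Ha3 : 0 < a ^ 3) by (apply pow_lt; lra).
  set (r := sqrt (a ^ 2 + 1)).
  assert (Hr2 : r * r = a ^ 2 + 1) by (apply sqrt_sqrt; nra).
  assert (Hr : 0 < r) by (apply sqrt_lt_R0; nra).
  assert (Hd : 0 < x ^ 2 - (a ^ 3) ^ 2) by nra.
  set (c := a ^ 3 / x). set (s := sqrt (1 - c ^ 2)).
  assert (Hc : 0 < c) by (apply Rdiv_lt_0_compat; lra).
  assert (Hc1 : 1 - c ^ 2 = (x ^ 2 - (a ^ 3) ^ 2) / x ^ 2)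
    by (unfold c; field; lra).
  assert (Hs0 : 0 < 1 - c ^ 2)
    by (rewrite Hc1; apply Rdiv_lt_0_compat; [exact Hd | apply pow_lt; lra]).
  assert (Hs : 0 < s) by now apply sqrt_lt_R0.
  assert (Hs2 : s * s = 1 - c ^ 2) by (apply sqrt_sqrt; lra).
  assert (Hys : 1 < s * (y - x)).
  { assert (1 < (s * (y - x)) ^ 2).
    { replace ((s * (y - x)) ^ 2) with (s * s * (y - x) ^ 2) by ring.
      rewrite Hs2, Hc1. apply (Rmult_lt_reg_l (x ^ 2)); [nra |].
      replace (x ^ 2 * ((x ^ 2 - (a ^ 3) ^ 2) / x ^ 2 * (y - x) ^ 2))
        with ((x ^ 2 - (a ^ 3) ^ 2) * (y - x) ^ 2) by (field; lra). lra. }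
    assert (0 < s * (y - x)) by nra. nra. }
  (* The tangent of v^(-1/2) at v = 1 / k^2, evaluated at v = u^2. *)
  assert (Htan : forall u k, 0 < u -> 0 < k -> k * (3 - u ^ 2 * k ^ 2) / 2 <= / u).
  { intros u k Hu Hk. apply (Rmult_le_reg_l u); [lra |].
    rewrite Rinv_r by lra.
    set (w := u * k). assert (0 < w) by (unfold w; nra).
    replace (u * (k * (3 - u ^ 2 * k ^ 2) / 2)) with (w * (3 - w ^ 2) / 2)
      by (unfold w; field).
    assert (0 <= (w - 1) ^ 2 * (w + 2))
      by (apply Rmult_le_pos; [apply pow2_ge_0 | lra]).
    replace (w * (3 - w ^ 2) / 2) with (1 - (w - 1) ^ 2 * (w + 2) / 2) by field.
    lra. }
  pose proof (Htan c (r / a) Hc ltac:(apply Rdiv_lt_0_compat; lra)) as H1.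
  pose proof (Htan s r Hs Hr) as H2.
  assert (H3 : / s < y - x).
  { apply (Rmult_lt_reg_l s); [lra |]. rewrite Rinv_r; lra. }
  assert (H4 : x = a ^ 3 * / c) by (unfold c; field; lra).
  apply (Rmult_le_compat_l (a ^ 3)) in H1; [| lra]. rewrite <- H4 in H1.
  assert (E : a ^ 3 * (r / a * (3 - c ^ 2 * (r / a) ^ 2) / 2)
    + r * (3 - s ^ 2 * r ^ 2) / 2 = r ^ 3).
  { replace (s ^ 2) with (1 - c ^ 2) by (rewrite <- Hs2; ring).
    transitivity (3 / 2 * r * (a ^ 2 + 1) - r ^ 3 / 2); [field; lra |].
    rewrite <- Hr2. field. }
  lra.
Qed.

Lemma bound_closed_form (m : R) : 0 < m ->
  Rpower (Rpower (2 * m) (2 / 3) + Rpower 2 (2 / 3)) (3 / 2) / 2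
  = sqrt (Rpower m (1 / 3) ^ 2 + 1) ^ 3.
Proof.
  intros Hm. set (a := Rpower m (1 / 3)).
  assert (Hs : 0 < a ^ 2 + 1) by (pose proof (pow2_ge_0 a); lra).
  assert (Ea : Rpower m (2 / 3) = a ^ 2).
  { unfold a. rewrite <- Rpower_pow by apply exp_pos. rewrite Rpower_mult.
    f_equal. simpl. field. }
  rewrite <- (Rpower_mult_distr 2 m) by lra.
  rewrite Ea.
  replace (Rpower 2 (2 / 3) * a ^ 2 + Rpower 2 (2 / 3))
    with (Rpower 2 (2 / 3) * (a ^ 2 + 1)) by ring.
  rewrite <- Rpower_mult_distr by (try apply exp_pos; lra).
  rewrite Rpower_mult. replace (2 / 3 * (3 / 2)) with 1 by field.
  rewrite Rpower_1 by lra.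
  rewrite <- (Rpower_sqrt (a ^ 2 + 1)) by lra.
  rewrite <- (Rpower_pow 3 (Rpower _ (/ 2))) by apply exp_pos. rewrite Rpower_mult.
  replace (/ 2 * INR 3) with (3 / 2) by (simpl; field). field.
Qed.

Theorem theorem4 (nu j : R) (hnu : nu > - (1 / 2))
  (hj : is_least_positive_zero (BesselJ nu) j) :
  j > Rpower (Rpower (2 * nu + 1) (2 / 3) + Rpower 2 (2 / 3)) (3 / 2) / 2.
Proof.
  destruct hj as [[Hj Ej] Hleast].
  set (m := nu + 1 / 2).
  assert (Hm : 0 < m) by (unfold m; lra).
  assert (HJF : forall x, 0 < x -> (BesselJ nu x = 0 <-> besselF nu ((x / 2) ^ 2) = 0)).
  { intros x Hx. rewrite BesselJ_besselF by exact Hx.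
    assert (Rpower (x / 2) nu <> 0) by (apply Rgt_not_eq, exp_pos).
    split; intros H0; [| rewrite H0; ring].
    apply Rmult_integral in H0. tauto. }
  (* The point x with (x/2)^2 = z. *)
  assert (Hroot : forall z, 0 < z -> 0 < 2 * sqrt z /\ (2 * sqrt z / 2) ^ 2 = z).
  { intros z Hz. pose proof (sqrt_lt_R0 z Hz).
    split; [lra |]. replace (2 * sqrt z / 2) with (sqrt z) by field.
    apply pow2_sqrt. lra. }
  set (z1 := (j / 2) ^ 2).
  assert (Hz1 : 0 < z1) by (apply pow_lt; lra).
  assert (E1 : besselF nu z1 = 0) by now apply HJF.
  assert (Hno : forall z, 0 < z < z1 -> besselF nu z <> 0).
  { intros z [Hz Hzz1] E. destruct (Hroot z Hz) as [Hx Ex].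
    assert (Hjx : j <= 2 * sqrt z).
    { apply Hleast; [exact Hx |]. apply HJF; [exact Hx |]. now rewrite Ex. }
    unfold z1 in Hzz1. rewrite <- Ex in Hzz1. nra. }
  destruct (balance_point nu z1 hnu Hz1 E1 Hno) as (z & [Hz Hzz1] & Ez).
  pose proof (besselF_before_first_zero nu z1 ltac:(lra) Hz1 Hno z ltac:(lra)) as HF.
  destruct (Hroot z Hz) as [Hx Ex]. set (x := 2 * sqrt z) in *.
  assert (Hxj : x < j) by (unfold z1 in Hzz1; rewrite <- Ex in Hzz1; nra).
  assert (P0 : besselP nu x 0 = besselF nu z)
    by (unfold besselP; rewrite Ex; simpl; rewrite Rplus_0_r; ring).
  assert (P1 : besselP nu x 1 = x / 2 * besselF (nu + 1) z)
    by (unfold besselP; rewrite Ex; simpl; ring).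
  assert (Q0 : besselP nu j 0 = 0)
    by (unfold besselP; fold z1; simpl; rewrite Rplus_0_r, E1; ring).
  assert (Q1 : 0 < besselP nu j 1).
  { unfold besselP. fold z1. simpl. rewrite Rmult_1_r.
    apply Rmult_lt_0_compat; [lra |].
    apply besselF_succ_pos_at_first_zero; auto; lra. }
  assert (Hbal : x * besselP nu x 1 = m * besselP nu x 0).
  { rewrite P0, P1. unfold m. rewrite <- Ez, <- Ex. field. }
  pose proof (first_zero_dominates nu x j (besselP nu x) (besselP nu j) ltac:(lra) Hx Hxj
    (fun k => besselP_rec nu x k ltac:(lra) Hx)
    (fun k => besselP_rec nu j k ltac:(lra) Hj)
    (besselP_lim nu x ltac:(lra) Hx) (besselP_lim nu j ltac:(lra) Hj)
    Q0 Q1 ltac:(now rewrite P0)) as HCS.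
  rewrite <- P0 in HF. set (u := besselP nu x 0) in *.
  (* Since J_(nu+1)/J_nu = m/x at x, s'(x) equals 1 - (m/x)^2. *)
  assert (Hsimp : x ^ 2 * (u ^ 2 + besselP nu x 1 ^ 2)
    - (2 * nu + 1) * x * u * besselP nu x 1 = u ^ 2 * (x ^ 2 - m ^ 2)).
  { replace (besselP nu x 1) with (m * u / x) by (rewrite <- Hbal; field; lra).
    unfold m. field. lra. }
  rewrite Hsimp in HCS.
  assert (Hkey : x ^ 2 < (x ^ 2 - m ^ 2) * (j - x) ^ 2).
  { apply (Rmult_lt_reg_l (u ^ 2 / (j - x) ^ 2)).
    { apply Rdiv_lt_0_compat; apply pow_lt; lra. }
    replace (u ^ 2 / (j - x) ^ 2 * x ^ 2) with ((x * u / (j - x)) ^ 2)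
      by (field; lra).
    replace (u ^ 2 / (j - x) ^ 2 * ((x ^ 2 - m ^ 2) * (j - x) ^ 2))
      with (u ^ 2 * (x ^ 2 - m ^ 2)) by (field; lra).
    exact HCS. }
  assert (Hmx : m < x).
  { apply Rnot_le_lt. intros Hle.
    assert (x ^ 2 - m ^ 2 <= 0) by nra.
    pose proof (pow2_ge_0 (j - x)). assert (0 < x ^ 2) by (apply pow_lt; lra). nra. }
  replace (2 * nu + 1) with (2 * m) by (unfold m; field).
  rewrite bound_closed_form by exact Hm.
  assert (Ea : Rpower m (1 / 3) ^ 3 = m).
  { rewrite <- Rpower_pow by apply exp_pos. rewrite Rpower_mult.
    replace (1 / 3 * INR 3) with 1 by (simpl; field). now apply Rpower_1. }
  apply (corner_bound _ x j);
    [apply exp_pos | now rewrite Ea | exact Hxj | now rewrite Ea].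
Qed.
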